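(* Let $T$ be a finite tree in which every vertex has odd degree, and suppose $|V(T)|\geq 5$. Let $\mathcal{Q}$ be the set of all paths $Q=v_1v_2\ldots v_n$ in $T$ ($n\ge 1$) such that \begin{itemize} \item at most $\frac{1}{2}(\deg_T v_n-1)$ of the neighbours of $v_n$ in $T$ are leaves, and \item for every $i\in[n-1]$, fewer than $\frac{1}{2}(\deg_T v_i-1)$ of the neighbours of $v_i$ in $T$ are leaves. \end{itemize} For $Q\in\mathcal{Q}$ set $t(Q)=|V(Q)|+1$ if $v_n$ is adjacent to a leaf, and $t(Q)=|V(Q)|$ otherwise. Then $$\tau(T)=\max_{Q\in\mathcal{Q}} t(Q).$$
   Context: Majority dynamics on a graph $G$ all of whose vertices have odd degree: given an initial opinion vector $\xi_0\in\{-1,1\}^{V(G)}$, for every $t\geq 1$ and every vertex $i$, $\xi_t(i)=\mathrm{sign}\sum_{j\in N_G(i)}\xi_{t-1}(j)$, where $N_G(i)$ is the set of neighbours of $i$. The stabilisation time is $\tau(G;\xi_0)=\min\{t\ge 0:\ \xi_{t+2}(i)=\xi_t(i)\text{ for all } i\in V(G)\}$, and $\tau(G)=\max_{\xi_0\in\{-1,1\}^{V(G)}}\tau(G;\xi_0)$. *)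

(* Defs.v *)
From mathcomp Require Import all_boot all_order all_algebra.
From mathcomp Require Import zify.

Set Implicit Arguments.
Unset Strict Implicit.
Unset Printing Implicit Defensive.

Import Order.TTheory GRing.Theory Num.Theory.

Record sgraph := SGraph {
  vertex :> finType;
  adj : rel vertex;
  adj_sym : symmetric adj;
  adj_irr : irreflexive adj
}.

Section Graph.
Variable G : sgraph.
Implicit Types (u v w : G) (p Q : seq G).

Definition nbr v : {set G} := [set w | adj v w].

Definition deg v : nat := #|nbr v|.

Definition odd_degrees : Prop := forall v, odd (deg v).

Definition is_leaf v : bool := deg v == 1.

Definition leaf_nbr v : {set G} := [set w in nbr v | is_leaf w].

Definition is_connected : Prop := forall u v, connect (@adj G) u v.

Definition is_acyclic : Prop := forall c : seq G, ucycle (@adj G) c -> size c < 3.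

Definition is_tree : Prop := [/\ 0 < #|G|, is_connected & is_acyclic].

Definition is_path Q : bool := [&& Q != [::], sorted (@adj G) Q & uniq Q].

(* The inequalities are doubled to avoid halving [deg v - 1]. *)
Definition admissible Q : bool :=
  is_path Q &&
  if Q is x :: p then
    (2 * #|leaf_nbr (last x p)| <= deg (last x p) - 1) &&
    all (fun v => 2 * #|leaf_nbr v| < deg v - 1) (belast x p)
  else false.

Definition path_time Q : nat :=
  if Q is x :: p then size Q + (leaf_nbr (last x p) != set0) else 0.

Local Open Scope ring_scope.

Definition nbr_sum (x : G -> int) v : int := \sum_(w in nbr v) x w.

Definition majority (x : G -> int) : G -> int := fun v => Num.sg (nbr_sum x v).

(* A vector of {-1,1}^V is encoded by a boolean vector, which makes the set of
   initial opinions a finite type. *)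
Definition spin (s : {ffun G -> bool}) : G -> int := fun v => (-1) ^+ s v.

Definition opinion (s : {ffun G -> bool}) (t : nat) : G -> int :=
  iter t majority (spin s).

Definition stable_at (s : {ffun G -> bool}) (t : nat) : bool :=
  [forall v, opinion s t.+2 v == opinion s t v].

(* Goles--Olivos: the opinions become periodic with period at most two, so the
   minimum defining the stabilisation time exists. *)
Section Stabilisation.
Hypothesis oddG : odd_degrees.

Definition pm1 (x : G -> int) : Prop := forall v, x v = 1 \/ x v = -1.

Lemma nbr_sum_neq0 x v : pm1 x -> nbr_sum x v != 0.
Proof.
move=> hx; have /(_ v) := oddG; rewrite /deg /nbr_sum -sum1_card.
suff: exists k : int, \sum_(w in nbr v) x w = (\sum_(w in nbr v) 1)%N%:Z - 2 * k.
  by case=> k ->; lia.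
elim/big_rec2: _ => [|w y1 y2 _ [k ->]]; first by exists 0.
by case: (hx w) => ->; [exists k | exists (k + 1)]; lia.
Qed.

Lemma opinion_pm1 s t : pm1 (opinion s t).
Proof.
elim: t => [|t IH] v /=.
  by rewrite /opinion /= /spin; case: (s v); [right | left].
have := nbr_sum_neq0 v IH; rewrite /opinion /= /majority.
by case: sgrP => // _ _; [left | right].
Qed.

Definition energy (s : {ffun G -> bool}) (t : nat) : int := \sum_v `|nbr_sum (opinion s t) v|.

Lemma energyE s t :
  energy s t = \sum_v opinion s t v * nbr_sum (opinion s t.+1) v.
Proof.
transitivity (\sum_v opinion s t.+1 v * nbr_sum (opinion s t) v).
  by apply: eq_bigr => v _; rewrite normrEsg.
rewrite /nbr_sum; under eq_bigr do rewrite mulr_sumr.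
under [RHS]eq_bigr do rewrite mulr_sumr.
rewrite (exchange_big_dep xpredT) //=; apply: eq_bigr => w _.
by apply: eq_big => [v|v _]; rewrite ?inE 1?adj_sym // mulrC.
Qed.

Lemma energy_lt s t : ~~ stable_at s t -> energy s t < energy s t.+1.
Proof.
rewrite negb_forall => /existsP[v nv]; rewrite energyE /energy.
have le w : opinion s t w * nbr_sum (opinion s t.+1) w <=
    `|nbr_sum (opinion s t.+1) w|.
  by case: (opinion_pm1 s t w) => ->; lia.
rewrite (bigD1 v) //= [ltRHS](bigD1 v) //=.
apply: ltr_leD; last by apply: ler_sum.
move: nv; rewrite [opinion s t.+2]/(majority (opinion s t.+1)) /majority.
have := nbr_sum_neq0 v (@opinion_pm1 s t.+1).
move: (nbr_sum (opinion s t.+1) v) => S.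
case: (opinion_pm1 s t v) => ->; case: (ltrgtP S 0) => [lt0|gt0|->] //.
- by rewrite (ltr0_sg lt0); lia.
- by rewrite (gtr0_sg gt0).
- by rewrite (ltr0_sg lt0).
- by rewrite (gtr0_sg gt0); lia.
Qed.

Lemma energy_le s t : energy s t <= (#|G| * #|G|)%N%:Z.
Proof.
have hc (A : {set G}) : (\sum_(w in A) 1 : int) <= #|G|%:Z.
  by rewrite sumr_const natz lez_nat max_card.
have -> : (#|G| * #|G|)%N%:Z = \sum_(v : G) #|G|%:Z :> int.
  by rewrite sumr_const -[RHS]mulr_natl natz PoszM.
apply: ler_sum => v _; apply: le_trans (hc (nbr v)).
apply: le_trans (ler_norm_sum _ _ _) _; apply: ler_sum => w _.
by case: (opinion_pm1 s t w) => ->.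
Qed.

Lemma stabilises (s : {ffun G -> bool}) : exists t, stable_at s t.
Proof.
pose n := (#|G| * #|G|)%N.
have [/existsP[t st]|/existsPn nst] :=
  boolP [exists t : 'I_n.+1, stable_at s t]; first by exists t.
have ge t : (t <= n.+1)%N -> t%:Z <= energy s t.
  elim: t => [|t IH] lt_t; first by apply: sumr_ge0.
  have := energy_lt (nst (Ordinal lt_t)); have := IH (ltnW lt_t) => /=; lia.
by have := ge _ (leqnn _); have := energy_le s n.+1; rewrite -/n; lia.
Qed.

Definition stab_time_from (s : {ffun G -> bool}) : nat := ex_minn (stabilises s).

Definition stab_time : nat := (\max_s stab_time_from s)%N.

End Stabilisation.

End Graph.

Definition is_max (A : Type) (P : A -> Prop) (f : A -> nat) (m : nat) : Prop :=
  (exists2 a, P a & f a = m) /\ (forall a, P a -> f a <= m).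

(* Main.v *)
Require Import Defs.
From mathcomp Require Import all_boot.
From mathcomp Require Import all_order all_algebra zify.

(** Call a flip of [v] at time [t] a change of opinion between times [t] and
    [t + 2].  A flip of [v] at time [t + 1] forces a neighbour [w] to flip in the
    same direction at time [t]; at time [t + 2] the vertex [w] already has the new
    opinion, whereas the vertex whose flip was explained by [v] still has the old
    one.  Tracing a late flip back in time therefore never backtracks and gives a
    path of the tree.  The leaves at [v] repeat the previous opinion of [v], so
    they vote against the flip, which bounds their number along the path.

    Conversely, given an admissible path [Q], the components of the forest [T - Q]
    attached through a non-leaf keep a constant opinion for ever, whatever happens
    on [Q].  Choosing these constants so that every vertex of [Q] but the first
    has exactly [(deg v - 1) / 2] positive neighbours makes a wave travel along [Q]
    at unit speed. *)

Set Implicit Arguments.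
Unset Strict Implicit.
Unset Printing Implicit Defensive.

Import Order.TTheory GRing.Theory Num.Theory.

Section Trees.
Variable G : sgraph.
Hypothesis oddG : odd_degrees G.
Implicit Types (u v w r : G) (p q Q : seq G) (s : {ffun G -> bool}) (b : int).

(** * Majority votes, leaves and flips *)

Definition agree s t b v : {set G} := [set w in nbr v | opinion s t w == b].

Definition unit_sign b : Prop := b = 1%R \/ b = (-1)%R.

Lemma unit_sign1 : unit_sign 1. Proof. by left. Qed.
Lemma unit_signN1 : unit_sign (-1)%R. Proof. by right. Qed.

Lemma nbr_sum_sign s t v b : unit_sign b ->
  (nbr_sum (opinion s t) v * b = 2 * #|agree s t b v|%:Z - (deg v)%:Z)%R.
Proof.
move=> hb; rewrite /nbr_sum mulr_suml.
have -> : (#|agree s t b v|%:Z = \sum_(w in nbr v) (opinion s t w == b)%:Z)%R.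
  rewrite -natz -sum1_card natr_sum (eq_bigl _ _ (fun w => in_set _ w)).
  by rewrite big_mkcondr; apply: eq_bigr => w _; case: ifP.
have -> : ((deg v)%:Z = \sum_(w in nbr v) 1)%R by rewrite sumr_const natz.
rewrite mulr_sumr -sumrB; apply: eq_bigr => w _.
by case: (opinion_pm1 oddG s t w) => ->; case: hb => ->.
Qed.

Lemma opinionS s t v b : unit_sign b ->
  (opinion s t.+1 v == b) = (deg v < 2 * #|agree s t b v|).
Proof.
move=> hb; have := nbr_sum_sign s t v hb.
rewrite /opinion iterS -/(opinion s t) /majority.
have := nbr_sum_neq0 oddG v (@opinion_pm1 _ oddG s t).
move: (nbr_sum _ _) => S; case: hb => ->; case: sgrP => //; lia.
Qed.

Lemma opinionN s t v b : unit_sign b ->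
  (opinion s t v == - b)%R = (opinion s t v != b).
Proof. by case: (opinion_pm1 oddG s t v) => ->; case=> ->. Qed.

Lemma unit_signN b : unit_sign b -> unit_sign (- b)%R.
Proof. by case=> ->; [right | left]; rewrite ?opprK. Qed.

Lemma card_agreeN s t v b : unit_sign b ->
  #|agree s t b v| + #|agree s t (- b)%R v| = deg v.
Proof.
move=> hb; rewrite /deg -(cardsID [set w | opinion s t w == b] (nbr v)).
congr (_ + _); apply: eq_card => w; rewrite !inE //.
by rewrite opinionN // andbC.
Qed.

Lemma leaf_nbr_unique v u w : is_leaf v -> adj v u -> adj v w -> u = w.
Proof.
move=> /cards1P[x nx] vu vw.
have /set1P-> : u \in [set x] by rewrite -nx inE.
by apply/esym/set1P; rewrite -nx inE.
Qed.

Lemma opinion_leaf s t v w : is_leaf w -> adj w v ->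
  opinion s t.+1 w = opinion s t v.
Proof.
move=> lw wv; have nw : nbr w = [set v].
  by apply/setP => u; rewrite !inE; apply/idP/eqP => [wu|-> //]; exact: leaf_nbr_unique wv.
rewrite /opinion iterS -/(opinion s t) /majority /nbr_sum nw big_set1.
by case: (opinion_pm1 oddG s t v) => ->.
Qed.

Lemma deg_gt0 v : 0 < deg v. Proof. by have := oddG v; case: deg. Qed.

Lemma deg_nonleaf v : ~~ is_leaf v -> 2 < deg v.
Proof. by have := oddG v; rewrite /is_leaf; case: deg => [|[|[|]]]. Qed.

(** A non-leaf has odd degree at least 3, so a single dissenter loses the vote; a leaf tolerates
    none. *)
Lemma majority_all_but_one s t v b (A : {set G}) : unit_sign b ->
    #|A| <= (~~ is_leaf v) ->
    (forall w, adj v w -> w \notin A -> opinion s t w = b) ->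
  opinion s t.+1 v = b.
Proof.
move=> hb cA h; apply/eqP; rewrite opinionS //.
have : nbr v \subset agree s t b v :|: A.
  apply/subsetP => w; rewrite !inE => vw; case: (boolP (w \in A)) => [|wA].
    by rewrite orbT.
  by rewrite vw h ?eqxx.
move=> /subset_leq_card/leq_trans/(_ (leq_card_setU _ _)); rewrite -/(deg v).
move: cA; case: (boolP (is_leaf v)) => [/eqP-> //|/deg_nonleaf]; lia.
Qed.

Lemma stableP s t :
  reflect (forall v, opinion s t.+2 v = opinion s t v) (stable_at s t).
Proof. exact: 'forall_eqP. Qed.

Lemma stableS s t : stable_at s t -> stable_at s t.+1.
Proof.
move=> /stableP st; apply/stableP => v.
rewrite -[LHS]/(Num.sg (nbr_sum (opinion s t.+2) v)); congr Num.sg.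
by apply: eq_bigr => w _; apply: st.
Qed.

Lemma stab_time_gt s t : ~~ stable_at s t -> t < stab_time oddG.
Proof.
move=> nst; apply: leq_trans (leq_bigmax s).
rewrite /stab_time_from; case: ex_minnP => m sm _; rewrite ltnNge.
apply: contra nst => le_mt; rewrite -(subnK le_mt).
by elim: (t - m) => [|k IH] //; apply: stableS.
Qed.

Lemma stab_time_unstable : 0 < stab_time oddG ->
  exists s, ~~ stable_at s (stab_time oddG).-1.
Proof.
rewrite /stab_time; have [|s ->] := @bigop.eq_bigmax _ (stab_time_from oddG).
  by apply/card_gt0P; exists [ffun=> true].
rewrite /stab_time_from; case: ex_minnP => m _ min_m m0; exists s.
by apply/negP => /min_m; case: m m0 {min_m} => // m _; rewrite ltnn.
Qed.

Definition flips s t b v : bool :=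
  (opinion s t v == - b)%R && (opinion s t.+2 v == b).

Lemma unstable_flips s t : ~~ stable_at s t ->
  exists b v, unit_sign b /\ flips s t b v.
Proof.
rewrite negb_forall => /existsP[v nv]; exists (opinion s t.+2 v), v.
have hb := opinion_pm1 oddG s t.+2 v; split=> //.
by rewrite /flips eqxx opinionN // eq_sym nv.
Qed.

Lemma flips_unstable s t b v : unit_sign b -> flips s t b v -> ~~ stable_at s t.
Proof.
move=> hb /andP[/eqP e1 /eqP e2]; apply/negP => /stableP/(_ v).
by rewrite e1 e2; case: hb => ->.
Qed.

(** * Upper bound *)

(** The neighbours of [v] holding [b] are a minority at time [t] and a majority at time [t.+2]. *)
Lemma flips_pred s t b v : unit_sign b -> flips s t.+1 b v ->
  exists2 w, adj v w & flips s t b w.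
Proof.
move=> hb /andP[]; rewrite !opinionS ?card_agreeN //; last exact: unit_signN.
move=> h1 h2; have e := card_agreeN s t v hb.
have /subsetPn[w] : ~~ (agree s t.+2 b v \subset agree s t b v).
  by apply/negP => /subset_leq_card; lia.
rewrite !inE => /andP[vw e2]; rewrite vw /= => e1.
by exists w => //; rewrite /flips e2 opinionN // e1.
Qed.

Lemma flips_leaf_nbr s t b v : unit_sign b -> flips s t b v ->
  2 * #|leaf_nbr v| <= deg v - 1.
Proof.
move=> hb /andP[/eqP e1]; rewrite opinionS // => h.
have e := card_agreeN s t.+1 v hb.
suff /subset_leq_card : leaf_nbr v \subset agree s t.+1 (- b)%R v by lia.
apply/subsetP => w; rewrite !inE => /andP[vw lw].
by rewrite vw (opinion_leaf _ _ lw (v := v)) ?e1 ?eqxx // adj_sym.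
Qed.

(** Besides the leaves, [u] also votes against the flip of [v]. *)
Lemma flips_leaf_nbr_strict s t b v u : unit_sign b -> flips s t b v ->
    adj v u -> ~~ is_leaf u -> (opinion s t.+1 u == - b)%R ->
  2 * #|leaf_nbr v| < deg v - 1.
Proof.
move=> hb /andP[/eqP e1]; rewrite opinionS // => h vu lu eu.
have e := card_agreeN s t.+1 v hb.
have := oddG v.
suff /subset_leq_card : u |: leaf_nbr v \subset agree s t.+1 (- b)%R v.
  by rewrite cardsU1 !inE vu lu; lia.
apply/subsetP => w; rewrite !inE => /predU1P[->|/andP[vw lw]].
  by rewrite vu eu.
by rewrite vw (opinion_leaf _ _ lw (v := v)) ?e1 ?eqxx // adj_sym.
Qed.

Hypothesis acG : is_acyclic G.

(** A walk from [u] that came back to [u] without backtracking would close a cycle of length at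
    least 3. *)
Lemma acyclic_uniq_cons u v w p : path (@adj G) u [:: v, w & p] ->
  uniq [:: v, w & p] -> u != w -> uniq [:: u, v, w & p].
Proof.
move=> pt un uw; rewrite cons_uniq un andbT; apply/negP => uin.
have uv : u != v by apply: contraTneq pt => ->; rewrite /= adj_irr.
move: uin; rewrite !inE (negPf uv) (negPf uw) /= => uin.
case/splitPr: uin pt un => p1 p2.
rewrite -!cat_cons cat_path cat_uniq => /andP[pt1 /andP[pu _]] /and3P[un1 hu _].
have : ucycle (@adj G) (u :: v :: w :: p1).
  apply/andP; split; first by rewrite /cycle rcons_path pt1.
  rewrite cons_uniq un1 andbT.
  by apply: contra hu => ui; rewrite /= ui.
by move/acG.
Qed.

(** Here [u] is the vertex whose flip at time [t.+1] is explained by [v]; the induction only needs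
    its old opinion at that time. *)
Lemma flips_path s t b v u : unit_sign b -> flips s t b v ->
    adj v u -> ~~ is_leaf u -> (opinion s t.+1 u == - b)%R ->
  exists p, [/\ path (@adj G) u (v :: p), uniq (u :: v :: p), size p = t
    & all (fun w => 2 * #|leaf_nbr w| < deg w - 1) (v :: p)].
Proof.
move=> hb; elim: t v u => [|t IH] v u fv vu lu eu;
  have sv := flips_leaf_nbr_strict hb fv vu lu eu; have uv := vu;
  rewrite adj_sym in uv.
  exists [::]; split; rewrite /= ?uv ?sv // inE andbT.
  by apply: contraTneq uv => ->; rewrite adj_irr.
have [w vw fw] := flips_pred hb fv.
have lv : ~~ is_leaf v by apply: contraTN sv => /eqP->.
have [||p [pt un sz al]] := IH w v fw _ lv; first by rewrite adj_sym.
  by case/andP: fv.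
exists (w :: p); split; rewrite /= ?sz //; last by rewrite sv.
  by move: pt => /= ->; rewrite uv.
apply: acyclic_uniq_cons => //; first by rewrite /= uv.
(* No backtracking: at time [t.+2], [w] already holds [b] while [u] still holds [- b]. *)
apply: contraTneq eu => ->; rewrite opinionN //.
by case/andP: fw => _ ->.
Qed.

Lemma admissible_rcons q v : admissible (rcons q v) =
  [&& sorted (@adj G) (rcons q v), uniq (rcons q v),
      2 * #|leaf_nbr v| <= deg v - 1
    & all (fun w => 2 * #|leaf_nbr w| < deg w - 1) q].
Proof.
rewrite /admissible /is_path -size_eq0 size_rcons /=.
case: q => [|x q] /=; first by rewrite /= andbT.
by rewrite last_rcons belast_rcons -!andbA.
Qed.

Lemma path_time_rcons q v :
  path_time (rcons q v) = (size q).+1 + (leaf_nbr v != set0).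
Proof.
by case: q => [|x q] //=; rewrite last_rcons size_rcons.
Qed.

Lemma flips_admissible s t b v : unit_sign b -> flips s t b v ->
    (~~ is_leaf v) || (t == 0) ->
  exists q, admissible (rcons q v) && (size q == t).
Proof.
move=> hb fv; have sv := flips_leaf_nbr hb fv.
case: t fv => [|t] fv; rewrite ?orbF => lv.
  by exists [::]; rewrite admissible_rcons /= sv.
have [w vw fw] := flips_pred hb fv.
have wv : adj w v by rewrite adj_sym.
have [|p [pt un sz al]] := flips_path hb fw wv lv; first by case/andP: fv.
have so : sorted (fun x y => adj y x) (v :: w :: p).
  by rewrite (eq_sorted (e' := @adj G)) // => x y; rewrite adj_sym.
(* The trace starts at [v] and goes back in time; the admissible path must end at [v]. *)
exists (rev (w :: p)); rewrite admissible_rcons -rev_cons size_rev.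
by rewrite rev_sorted so rev_uniq un sv all_rev al /= sz.
Qed.

(** A leaf flipping at a positive time copies its neighbour [w]. The path then ends at [w], one
    vertex shorter, and the leaf bonus in [path_time] makes up for it. *)
Lemma flips_path_time s t b v : unit_sign b -> flips s t b v ->
  exists2 Q : seq G, admissible Q & t < path_time Q.
Proof.
move=> hb fv; case: (boolP (~~ is_leaf v || (t == 0))) => [lv|].
  have [q /andP[aq /eqP sq]] := flips_admissible hb fv lv.
  by exists (rcons q v); rewrite // path_time_rcons sq addSn ltnS leq_addr.
rewrite negb_or negbK => /andP[lv]; case: t fv => // t fv _.
have [w vw fw] := flips_pred hb fv.
have nw : leaf_nbr w != set0.
  by apply/set0Pn; exists v; rewrite !inE adj_sym vw.
have lw : ~~ is_leaf w.
  by move: nw (flips_leaf_nbr hb fw); rewrite -card_gt0 /is_leaf => ? ?; lia.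
have [|q /andP[aq /eqP sq]] := flips_admissible hb fw; first by rewrite lw.
by exists (rcons q w); rewrite // path_time_rcons nw sq addn1.
Qed.

(** A vertex without leaf neighbours is an admissible path by itself. Any leaf is such a vertex,
    since two adjacent leaves would form a whole component. *)
Lemma ex_admissible : is_connected G -> 2 < #|G| -> exists Q, @admissible G Q.
Proof.
move=> cG G2; have adm1 v : leaf_nbr v = set0 -> exists Q, @admissible G Q.
  by move=> lv; exists (rcons [::] v); rewrite admissible_rcons /= lv cards0.
have [x _] : exists x : G, x \in G by apply/card_gt0P/(leq_ltn_trans _ G2).
have [/existsP[v]|/existsPn nl] := boolP [exists v : G, is_leaf v]; last first.
  apply: (adm1 x); apply/setP => w; rewrite !inE.
  by rewrite (negPf (nl w)) andbF.
have [w vw] : exists w, w \in nbr v by apply/card_gt0P/deg_gt0.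
rewrite inE in vw => lv; apply: (adm1 v); apply/setP => u; rewrite !inE.
apply/negP => /andP[vu lu]; have e := leaf_nbr_unique lv vu vw.
rewrite {}e in vu lu.
have cl : closed (@adj G) [set v; w].
  apply: intro_closed => [|y z yz]; first by apply: sym_connect_sym; apply: adj_sym.
  rewrite !inE => /orP[]/eqP e; rewrite {}e in yz.
    by rewrite (leaf_nbr_unique lv yz vw) eqxx orbT.
  by rewrite (leaf_nbr_unique lu yz (w := v)) ?eqxx // adj_sym.
suff : #|G| <= #|[set v; w]| by rewrite cards2; lia.
apply/subset_leq_card/subsetP => y _.
by rewrite -(closed_connect cl (cG v y)) !inE eqxx.
Qed.


(** * Lower bound *)

Section Wave.

(** * A path in a tree and the components off it *)

Variable Q : seq G.
Hypotheses (srtQ : sorted (@adj G) Q) (unQ : uniq Q).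

(** A chord would close the segment of [Q] between its ends, called [c] below, into a cycle. *)
Lemma path_adj_index u v : u \in Q -> v \in Q -> adj u v ->
  index u Q = (index v Q).+1 \/ index v Q = (index u Q).+1.
Proof.
wlog lt_uv : u v / index u Q < index v Q => [W uQ vQ uv|].
  have [lt|lt|e] := ltngtP (index u Q) (index v Q); first exact: W.
    by rewrite or_comm; apply: W => //; rewrite adj_sym.
  by move: uv; rewrite -(nth_index u uQ) e nth_index // adj_irr.
move=> uQ vQ uv; right.
set i := index u Q in lt_uv *; set j := index v Q in lt_uv *.
have ltj : j < size Q by rewrite index_mem.
pose c := take (j - i).+1 (drop i Q).
have szc : size c = (j - i).+1 by rewrite size_take size_drop; case: ltnP; lia.
have cE : c = u :: behead c.
  by rewrite /c (drop_nth u) ?(ltn_trans lt_uv) //= nth_index.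
have lc : last u (behead c) = v.
  have -> : last u (behead c) = last u c by rewrite cE.
  rewrite -nth_last szc /= nth_take // nth_drop subnKC ?nth_index //.
  exact: ltnW.
have /acG : ucycle (@adj G) c; last by rewrite szc; lia.
apply/andP; split; last by rewrite take_uniq // drop_uniq.
have : sorted (@adj G) c by rewrite take_sorted // drop_sorted.
by rewrite cE /= rcons_path lc adj_sym uv andbT.
Qed.

Let on_adj : rel G := [rel u v | [&& adj u v, u \in Q & v \in Q]].
Let off_adj : rel G := [rel u v | [&& adj u v, u \notin Q & v \notin Q]].

Lemma connect_on_path u v : u \in Q -> v \in Q -> connect on_adj u v.
Proof.
have sym : connect_sym on_adj.
  by apply: sym_connect_sym => x y; rewrite /on_adj /= adj_sym [X in _ && X]andbC.
move=> uQ vQ; have := uQ; case eQ: {1}Q => [|x q] // _.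
have hx w : w \in Q -> connect on_adj x w.
  rewrite eQ => wq; apply: (@path_connect _ _ x q) => //.
  have := srtQ; rewrite eQ /=; apply: (sub_in_path (P := [in Q])).
    by move=> y z yQ zQ yz; apply/and3P.
  by apply/allP => y; rewrite -eQ.
apply: connect_trans (hx v vQ).
by rewrite sym hx.
Qed.

(** Each component off [Q] hangs on a single edge: two edges to [Q] would give a cycle, made of a
    path inside [Q] and one outside it. *)
Lemma off_path_attachment u v r r' : u \in Q -> v \in Q -> r \notin Q ->
  adj u r -> adj v r' -> connect off_adj r r' -> u = v /\ r = r'.
Proof.
move=> uQ vQ rQ ur vr' rr'.
have /connectP[p pt lp] := connect_on_path vQ uQ.
case/shortenP: pt lp => {}p pt un _ lp.
have /connectP[p' pt' lp'] := rr'.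
case/shortenP: pt' lp' => {}p' pt' un' _ lp'.
have pQ : {subset v :: p <= Q}.
  move=> w; rewrite inE => /predU1P[->//|].
  elim: (p) (v) pt => //= y q IH x /andP[/and3P[_ _ yQ] /IH{}IH].
  by rewrite inE => /predU1P[->|/IH].
have p'Q w : w \in r :: p' -> w \notin Q.
  rewrite inE => /predU1P[->//|].
  elim: (p') (r) pt' => //= y q IH x /andP[/and3P[_ _ yQ] /IH{}IH].
  by rewrite inE => /predU1P[->|/IH].
have /acG : ucycle (@adj G) ((v :: p) ++ r :: p').
  apply/andP; split; last first.
    rewrite cat_uniq un un' andbT; apply/hasPn => w /p'Q; apply: contra.
    exact: pQ.
  rewrite /= rcons_cat cat_path -lp /= ur rcons_path -lp' adj_sym vr' andbT.
  by apply/andP; split; [move: pt | move: pt'];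
    apply: sub_path => x y /= /and3P[].
by case: (p) lp (p') lp' => [|? ?] /= -> [|? ?] //= ->; rewrite ?size_cat //=; lia.
Qed.
(** Both leaf conditions of [admissible] at once: the boolean makes the inequality strict except at
    the last vertex. *)
Hypothesis leafQ : forall v, v \in Q ->
  2 * #|leaf_nbr v| + ((index v Q).+1 < size Q) <= deg v - 1.

(** * The initial opinions of the wave *)

Definition side v : {set G} := [set r in nbr v | (r \notin Q) && ~~ is_leaf r].

Lemma card_nbr_on_path v : v \in Q ->
  #|nbr v :&: [set w in Q]| <= (0 < index v Q) + ((index v Q).+1 < size Q).
Proof.
move=> vQ; pose at_index i := [set w in Q | index w Q == i].
have card_at i : #|at_index i| <= 1.
  apply/card_le1P => x; rewrite inE => /andP[xQ /eqP ex] y.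
  rewrite !inE; apply/andP/eqP => [[yQ /eqP ey]|-> //]; last by rewrite xQ ex.
  by rewrite -(nth_index x yQ) ey -ex nth_index.
(* At index 0 the truncated predecessor is 0 again, that is [v] itself, which is removed by
   intersecting with [nbr v]. *)
have prev0 : 0 < index v Q \/ at_index (index v Q).-1 :&: nbr v = set0.
  case: posnP => [e|]; [right | by left].
  apply/setP => x; rewrite !inE e -andbA; apply/and3P => -[xQ /eqP ex vx].
  by have := path_adj_index vQ xQ vx; rewrite ex e => -[].
have next0 : (index v Q).+1 < size Q \/ at_index (index v Q).+1 = set0.
  case: ltnP => [|le]; [by left | right].
  apply/setP => x; rewrite !inE; apply/andP => -[xQ /eqP ex].
  by move: xQ; rewrite -index_mem ex ltnNge le.
have sub : nbr v :&: [set w in Q] \subset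
    (at_index (index v Q).-1 :&: nbr v) :|: at_index (index v Q).+1.
  apply/subsetP => x; rewrite !inE => /andP[vx xQ]; rewrite vx xQ /=.
  by have [->|->] := path_adj_index vQ xQ vx; rewrite eqxx ?orbT.
apply: leq_trans (subset_leq_card sub) _.
apply: leq_trans (leq_card_setU _ _) _; apply: leq_add.
  case: prev0 => [->|->]; last by rewrite cards0.
  exact: leq_trans (subset_leq_card (subsetIl _ _)) (card_at _).
by case: next0 => [->|->]; rewrite ?cards0.
Qed.

(** Side neighbours are a strict majority at the first vertex, and number at least [(deg v).-1./2]
    elsewhere, enough for the quota below. Oddness of [deg v] gains the unit that counting leaves
    and path neighbours loses. *)
Lemma card_side v : v \in Q ->
  deg v + (index v Q == 0) <= 2 * #|side v| + (index v Q != 0).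
Proof.
move=> vQ; have := card_nbr_on_path vQ; have := leafQ vQ; have := oddG v.
have sub : nbr v \subset side v :|: leaf_nbr v :|: (nbr v :&: [set w in Q]).
  by apply/subsetP => x; rewrite !inE => ->; case: (x \in Q) (is_leaf x) => [] [].
have := leq_trans (subset_leq_card sub) (leq_card_setU _ _).
have [+ _] := leq_card_setU (side v) (leaf_nbr v); rewrite -/(deg v) -lt0n.
by case: (_.+1 < _); case: posnP => _ /=; lia.
Qed.

(* For later vertices the quota leaves [v] one vote short of a positive majority,
   a vote that the predecessor of [v] on [Q] provides. *)
Definition quota v := if index v Q == 0 then #|side v| else (deg v).-1./2.

Definition picked v : {set G} := [set r in take (quota v) (enum (side v))].

Lemma picked_sub v : picked v \subset side v.
Proof. by apply/subsetP => r; rewrite inE => /mem_take; rewrite mem_enum. Qed.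

Lemma card_picked v : v \in Q -> #|picked v| = quota v.
Proof.
move=> vQ; rewrite cardsE (card_uniqP _) ?take_uniq ?enum_uniq //.
rewrite size_take -cardE; have := card_side vQ; have := oddG v; rewrite /quota.
by case: eqP => _ /=; case: ltnP => //; lia.
Qed.

Definition plus_set : {set G} :=
  [set w | [exists v in Q, exists r in picked v, connect off_adj r w]].

(** Since [spin] reads [true] as -1, the components of the picked roots start at 1 and all the rest,
    [Q] included, at -1. *)
Definition wave : {ffun G -> bool} := [ffun w => w \notin plus_set].

Lemma plus_setP w :
  reflect (exists v r, [/\ v \in Q, r \in picked v & connect off_adj r w])
    (w \in plus_set).
Proof.
rewrite inE; apply: (iffP exists_inP) => [[v vQ /exists_inP[r]]|[v [r [vQ]]]].
  by exists v, r.
by exists v => //; apply/exists_inP; exists r.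
Qed.

Lemma pickedP v r : r \in picked v -> [/\ adj v r, r \notin Q & ~~ is_leaf r].
Proof. by move/(subsetP (picked_sub v)); rewrite !inE => /and3P. Qed.

Lemma plus_off w : w \in plus_set -> w \notin Q.
Proof.
case/plus_setP => v [r [vQ /pickedP[_ rQ _] /connectP[p]]].
elim: p r rQ => [|y p IH] r rQ /= => [_ -> //|/andP[/and3P[_ _ yQ] pt]].
exact: IH.
Qed.

Lemma plus_closed u w : u \in plus_set -> adj u w -> w \notin Q ->
  w \in plus_set.
Proof.
move=> up uw wQ; have uQ := plus_off up.
case/plus_setP: up => v [r [vQ rp ru]]; apply/plus_setP; exists v, r; split=> //.
by apply: connect_trans ru (connect1 _); apply/and3P.
Qed.

Lemma plus_picked v w : w \in plus_set -> v \in Q -> adj v w -> w \in picked v.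
Proof.
case/plus_setP => u [r [uQ rp rw]] vQ vw; have [ur rQ _] := pickedP rp.
by have [<- <-] := off_path_attachment uQ vQ rQ ur vw rw.
Qed.

(** * Evolution of the wave *)

Lemma nbr_on_path_unique u v w : w \notin Q -> u \in Q -> v \in Q ->
  adj w u -> adj w v -> u = v.
Proof.
rewrite adj_sym [adj w v]adj_sym => wQ uQ vQ uw vw.
by case: (off_path_attachment uQ vQ wQ uw vw (connect0 _ _)).
Qed.

Lemma card_nbr_off_path w : w \notin Q -> #|[set v in Q | adj w v]| <= 1.
Proof.
move=> wQ; apply/card_le1_eqP => u v; rewrite !inE => /andP[uQ wu] /andP[vQ wv].
exact: nbr_on_path_unique wu.
Qed.

(** Only one neighbour of [w] can lie on [Q], and none if [w] is a leaf, because picked roots are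
    not leaves. *)
Lemma wave_plus t w : w \in plus_set -> opinion wave t w = 1%R.
Proof.
elim: t w => [|t IH] w wp; first by rewrite /opinion /= /spin ffunE wp.
apply: (majority_all_but_one (A := [set v in Q | adj w v])).
- exact: unit_sign1.
- case: (boolP (is_leaf w)) => [lw|_]; last exact/card_nbr_off_path/plus_off.
  rewrite leqn0 cards_eq0; apply/eqP/setP => v; rewrite !inE.
  apply/negP => /andP[vQ]; rewrite adj_sym => /(plus_picked wp vQ)/pickedP[_ _].
  by rewrite lw.
move=> v wv; rewrite inE wv andbT => vQ.
by apply: IH; apply: plus_closed wv _.
Qed.

(* Overestimates the vertices of opinion [1] at time [t]: the vertex of index [k]
   on [Q] turns to [1] at time [k + 1], its leaves one step later. *)
Definition reached t w : bool :=
  [|| w \in plus_set, (w \in Q) && (index w Q < t)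
    | is_leaf w && [exists v in Q, adj w v && ((index v Q).+1 < t)]].

Lemma reached_leaf t w v : adj v w -> v \notin Q ->
  is_leaf w && [exists u in Q, adj w u && ((index u Q).+1 < t)] = false.
Proof.
move=> vw vQ; apply/negP => /andP[lw /exists_inP[u uQ /andP[wu _]]].
by rewrite adj_sym in vw; case/negP: vQ; rewrite (leaf_nbr_unique lw vw wu).
Qed.

Lemma wave_minus t w : ~~ reached t w -> opinion wave t w = (-1)%R.
Proof.
elim: t w => [|t IH] w; rewrite /reached !negb_or => /and3P[wp wQt wl].
  by rewrite /opinion /= /spin ffunE wp.
have [wQ|wQ] := boolP (w \in Q).
  rewrite wQ /= -leqNgt in wQt; apply/eqP; rewrite (opinionS _ _ _ unit_signN1).
  have e := card_agreeN wave t w unit_sign1.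
  (* Reached vertices of [Q] are at least two indices behind [w], hence not adjacent to it; only
     picked roots can vote 1, and they fall short of a majority. *)
  have : agree wave t 1%R w \subset picked w.
    apply/subsetP => u; rewrite !inE => /andP[wu].
    have [|/IH-> //] := boolP (reached t u); case/or3P => [up _|/andP[uQ iu]|].
    - by have := plus_picked up wQ wu; rewrite inE.
    - by have := path_adj_index wQ uQ wu; lia.
    - case/andP=> lu /exists_inP[v vQ /andP[uv iv]].
      by rewrite adj_sym in wu; rewrite -(leaf_nbr_unique lu wu uv) in iv; lia.
  move/subset_leq_card; rewrite card_picked // /quota.
  case: eqP wQt => [->//|_ _]; move: e (oddG w).
  by move: #|agree _ _ 1%R w| #|agree _ _ (-1)%R w| => m n; lia.
apply: (majority_all_but_one (A := [set v in Q | adj w v && reached t v])).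
- exact: unit_signN1.
- have [lw|lw] := boolP (is_leaf w); last first.
    apply: leq_trans (card_nbr_off_path wQ); apply: subset_leq_card.
    by apply/subsetP => u; rewrite !inE => /and3P[-> ->].
  rewrite leqn0 cards_eq0; apply/eqP/setP => v; rewrite !inE.
  apply/negP => /and3P[vQ wv]; rewrite /reached (reached_leaf _ wv) // orbF.
  case/orP => [/plus_off|/andP[_ iv]]; first by rewrite vQ.
  move: wl; rewrite lw /= => /exists_inPn/(_ v vQ).
  by rewrite wv ltnS iv.
move=> u wu; rewrite inE wu /= => uA; apply: IH; apply: contra uA => ur.
rewrite ur andbT; move: ur; rewrite /reached (reached_leaf _ wu) // orbF.
case/orP => [up|/andP[] //]; case/negP: wp.
by apply: plus_closed up _ wQ; rewrite adj_sym.
Qed.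

Lemma wave_front v : v \in Q -> flips wave (index v Q) 1%R v.
Proof.
move=> vQ; apply/andP; split.
  rewrite wave_minus // /reached !negb_or vQ ltnn /=; apply/andP; split.
    by apply/negP => /plus_off; rewrite vQ.
  rewrite negb_and; apply/orP; right; apply/exists_inPn => u uQ.
  by apply/negP => /andP[vu]; case: (path_adj_index vQ uQ vu); lia.
(* The opinion at time [k.+2] follows by induction on the index [k]. *)
move: {2 3}(index v Q) (erefl (index v Q)) => k.
elim: k v vQ => [|k IH] v vQ ek; rewrite (opinionS _ _ _ unit_sign1).
  have : picked v \subset agree wave 1 1%R v.
    apply/subsetP => r rp; have [vr _ _] := pickedP rp.
    rewrite !inE vr wave_plus //; apply/plus_setP; exists v, r.
    by rewrite connect0.
  move/subset_leq_card; rewrite card_picked // /quota ek /=.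
  by have := card_side vQ; rewrite ek /=; have := deg_gt0 v; lia.
have ltk : k < size Q by move: vQ; rewrite -index_mem ek => /ltnW.
set u := nth v Q k.
have uQ : u \in Q by rewrite mem_nth.
have iu : index u Q = k by rewrite index_uniq.
have uv : adj v u.
  rewrite adj_sym -(nth_index v vQ) ek.
  by apply: (sortedP v _) => //; rewrite -ek index_mem.
(* The predecessor [u] supplies the one vote missing from the quota. *)
have : u |: picked v \subset agree wave k.+2 1%R v.
  apply/subsetP => r; rewrite in_setU1 => /predU1P[->|rp].
    by rewrite !inE uv IH.
  have [vr _ _] := pickedP rp.
  rewrite !inE vr wave_plus //; apply/plus_setP; exists v, r.
  by rewrite connect0.
move/subset_leq_card; rewrite cardsU1 card_picked // /quota ek /=.
have -> : u \notin picked v by apply/negP => /pickedP[_]; rewrite uQ.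
by have := oddG v; lia.
Qed.

End Wave.

(** The last vertex of [Q] flips at time [size q], and a leaf adjacent to it one step later. *)
Lemma admissible_path_time Q : admissible Q -> path_time Q <= stab_time oddG.
Proof.
case/lastP: Q => [//|q v]; rewrite admissible_rcons path_time_rcons.
case/and4P => so un wk st; set Q := rcons q v in so un *.
have vQ : v \in Q by rewrite mem_rcons mem_head.
have iv : index v Q = size q.
  by move: un; rewrite /Q rcons_uniq -cats1 index_cat => /andP[/negPf-> _] /=;
    rewrite eqxx addn0.
have leafQ w : w \in Q ->
    2 * #|leaf_nbr w| + ((index w Q).+1 < size Q) <= deg w - 1.
  rewrite mem_rcons inE => /predU1P[->|wq].
    by rewrite iv size_rcons ltnn addn0.
  by apply: leq_trans (allP st w wq); rewrite -[leqRHS]addn1 leq_add2l leq_b1.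
have fl := wave_front so un leafQ vQ; rewrite iv in fl.
case: set0Pn => [[w]|_]; last first.
  by rewrite addn0; apply: stab_time_gt (flips_unstable unit_sign1 fl).
rewrite !inE adj_sym addn1 => /andP[wv lw].
apply: (@stab_time_gt (wave Q)); apply: (flips_unstable (v := w) unit_sign1).
by rewrite /flips !(opinion_leaf _ _ lw wv).
Qed.

End Trees.

Theorem theorem1 (T : sgraph) (oddT : odd_degrees T) :
  is_tree T -> 5 <= #|T| ->
  is_max (fun Q : seq T => admissible Q) (@path_time T) (stab_time oddT).
Proof.
move=> [_ cT acT] T5; have ub := admissible_path_time oddT acT.
suff [Q aQ leQ] : exists2 Q : seq T, admissible Q & stab_time oddT <= path_time Q.
  by split=> [|R /ub //]; exists Q => //; apply/eqP; rewrite eqn_leq leQ ub.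
(* With stabilisation time 0 there is no flip to trace, and any admissible path will do. *)
case: (posnP (stab_time oddT)) => [->|tau_gt0].
  by have [|Q aQ] := ex_admissible oddT cT; [apply: leq_trans T5 | exists Q].
have [s /unstable_flips[//|b [v [hb fv]]]] := stab_time_unstable tau_gt0.
have [Q aQ lt] := flips_path_time oddT acT hb fv.
by exists Q => //; rewrite prednK in lt.
Qed.
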